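(* Let $P\bowtie G$ be a Zappa-Szép product of a semigroup $P$ and a group $G$, let $\mathcal{A}$ be a unital C*-algebra, let $X=\bigsqcup_{p\in P}X_p$ be a product system over $P$ with coefficient $\mathcal{A}$, and let $\beta$ be a Zappa-Szép action of $G$ on $X$. For $(p,g)\in P\bowtie G$ let $Y_{(p,g)}=\{x\otimes g: x\in X_p\}$ be the $\mathcal{A}$-correspondence with $$a\cdot(x\otimes g)=(a\cdot x)\otimes g,\qquad (x\otimes g)\cdot a=x\beta_g(a)\otimes g,\qquad \langle x\otimes g,y\otimes g\rangle=\beta_{g^{-1}}(\langle x,y\rangle)$$ for $a\in\mathcal{A}$, $x,y\in X_p$. Let $Y=\bigsqcup_{(p,g)\in P\bowtie G}Y_{(p,g)}$, with multiplication maps $Y_{(p,g)}\times Y_{(q,h)}\to Y_{(p(g\cdot q),\,g|_q h)}$ given by $$(x\otimes g)(y\otimes h)=(x\beta_g(y))\otimes (g|_q)h\qquad (x\in X_p,\ y\in X_q).$$ Then, with these multiplication maps (and with $Y_{(e,e)}$ identified with $\mathcal{A}$ via $a\otimes e\leftrightarrow a$), $Y$ is a product system over $P\bowtie G$ with coefficient $\mathcal{A}$.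
   Context: Semigroups and groups are discrete, and every semigroup has an identity, written $e$ (the identity of $G$ is also written $e$). Zappa-Szép product. One is given a left action $G\times P\to P$, $(g,p)\mapsto g\cdot p$, and a map $P\times G\to G$, $(p,g)\mapsto g|_p$, such that for all $g,h\in G$, $p,q\in P$: $e\cdot p=p$; $(gh)\cdot p=g\cdot(h\cdot p)$; $g\cdot e=e$; $g|_e=g$; $g\cdot(pq)=(g\cdot p)(g|_p\cdot q)$; $g|_{pq}=(g|_p)|_q$; $e|_p=e$; $(gh)|_p=g|_{h\cdot p}\,h|_p$. Then $P\bowtie G=P\times G$ with product $(p,g)(q,h)=(p(g\cdot q),\,g|_q h)$ is a semigroup with identity $(e,e)$. Product system. An $\mathcal{A}$-correspondence is a right Hilbert $\mathcal{A}$-module with a left action of $\mathcal{A}$ by adjointable operators. A product system over a semigroup $P$ with coefficient $\mathcal{A}$ is $X=\bigsqcup_{p\in P}X_p$, with each $X_p$ an $\mathcal{A}$-correspondence, with an associative multiplication $X_p\times X_q\to X_{pq}$ such that (1) $X_e=\mathcal{A}$ as an $\mathcal{A}$-correspondence; (2) for all $p,q\in P$ the multiplication extends to a unitary $M_{p,q}:X_p\otimes X_q\to X_{pq}$ (interior tensor product over $\mathcal{A}$); (3) the left and right actions of $\mathcal{A}$ on $X_p$ coincide with the multiplications $X_e\times X_p\to X_p$ and $X_p\times X_e\to X_p$. Zappa-Szép action of $G$ on $X$: a collection $\beta=\{\beta_g\}_{g\in G}$ of maps on $X$ such that (A1) for each $p\in P$, $g\in G$, $\beta_g$ restricts to a $\mathbb{C}$-linear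 map $X_p\to X_{g\cdot p}$; (A2) $\beta_g\circ\beta_h=\beta_{gh}$; (A3) $\beta_e$ is the identity; (A4) each $\beta_g$ is a $*$-automorphism of $X_e=\mathcal{A}$; (A5) $\beta_g(xy)=\beta_g(x)\beta_{g|_p}(y)$ for $x\in X_p$, $y\in X_q$; (A6) $\langle\beta_g(x),\beta_g(y)\rangle=\beta_{g|_p}(\langle x,y\rangle)$ for $x,y\in X_p$. *)

(* Defs.v *)
From HB Require Import structures.
From mathcomp Require Import all_boot all_order all_algebra.
From mathcomp Require Import complex.
From mathcomp Require Import all_classical all_reals all_analysis.

Set Implicit Arguments.
Unset Strict Implicit.
Unset Printing Implicit Defensive.

Import Order.TTheory GRing.Theory Num.Theory.
Import numFieldNormedType.Exports.

Local Open Scope ring_scope.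

(* Unital C*-algebras over C = R[i].  The ring operations are fields of the    *)
(* mixin because HB rejects a new join of a ring with a normed module that is  *)
(* not a Num.NumDomain ("missing join").  The zero algebra is not excluded.    *)

HB.mixin Record NormedModule_isCStarAlg (R : realType) A
    of CompleteNormedModule R[i] A := {
  cmul : A -> A -> A;
  cone : A;
  star : A -> A;
  cmulA : associative cmul;
  cmul1 : left_id cone cmul;
  cmulr1 : right_id cone cmul;
  cmulDl : left_distributive cmul +%R;
  cmulDr : right_distributive cmul +%R;
  cmulZl : forall (c : R[i]) (a b : A), cmul (c *: a) b = c *: cmul a b;
  cmulZr : forall (c : R[i]) (a b : A), cmul a (c *: b) = c *: cmul a b;
  cnorm_mul : forall a b : A, `|cmul a b| <= `|a| * `|b|;
  starK : involutive star;
  starD : {morph star : a b / a + b};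
  starZ : forall (c : R[i]) (a : A), star (c *: a) = c^* *: star a;
  starM : forall a b : A, star (cmul a b) = cmul (star b) (star a);
  cnorm_star : forall a : A, `|cmul (star a) a| = `|a| ^+ 2
}.

#[short(type="cstarAlgType")]
HB.structure Definition CStarAlg (R : realType) :=
  { A of CompleteNormedModule R[i] A & NormedModule_isCStarAlg R A }.

Notation "a *c b" := (cmul a b) (at level 40, left associativity) : ring_scope.

Section CStarAlgebra.
Variables (R : realType) (A : cstarAlgType R).

Definition cstar_ge0 (a : A) : Prop := exists b : A, a = star b *c b.

Definition star_automorphism (f : A -> A) : Prop :=
  [/\ bijective f, linear f, f cone = cone,
      (forall a b, f (a *c b) = f a *c f b) & (forall a, f (star a) = star (f a))].

End CStarAlgebra.

(* Hilbert modules and correspondences are given as operations (hmod, corr)    *)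
(* together with predicates (is_hilbert, is_correspondence).                   *)

Record hmod (R : realType) (A : cstarAlgType R) := HMod {
  hmod_sort :> lmodType R[i];
  ract : hmod_sort -> A -> hmod_sort;
  inner : hmod_sort -> hmod_sort -> A
}.

Record corr (R : realType) (A : cstarAlgType R) := Corr {
  corr_hmod :> hmod A;
  lact : A -> corr_hmod -> corr_hmod
}.

Section Modules.
Variables (R : realType) (A : cstarAlgType R).

Definition hnorm (E : hmod A) (x : E) : R[i] := sqrtC `|inner x x|.

Definition hcauchy (E : hmod A) (u : nat -> E) : Prop :=
  forall e : R[i], 0 < e ->
  exists N, forall m n, (N <= m)%N -> (N <= n)%N -> hnorm (u m - u n) < e.

Definition hcvg (E : hmod A) (u : nat -> E) (l : E) : Prop :=
  forall e : R[i], 0 < e ->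
  exists N, forall n, (N <= n)%N -> hnorm (u n - l) < e.

(* The inner product is linear in its second argument.  Its sesquilinearity    *)
(* in the first one follows by hilb_innerC.                                    *)
Record is_hilbert (E : hmod A) : Prop := IsHilbert {
  hilb_ractDl : forall (x y : E) a, ract (x + y) a = ract x a + ract y a;
  hilb_ractDr : forall (x : E) a b, ract x (a + b) = ract x a + ract x b;
  hilb_ractZl : forall (c : R[i]) (x : E) a, ract (c *: x) a = c *: ract x a;
  hilb_ractZr : forall (c : R[i]) (x : E) a, ract x (c *: a) = c *: ract x a;
  hilb_ractM : forall (x : E) a b, ract x (a *c b) = ract (ract x a) b;
  hilb_ract1 : forall x : E, ract x cone = x;
  hilb_innerD : forall x y z : E, inner x (y + z) = inner x y + inner x z;
  hilb_innerZ : forall (c : R[i]) (x y : E), inner x (c *: y) = c *: inner x y;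
  hilb_innerA : forall (x y : E) a, inner x (ract y a) = inner x y *c a;
  hilb_innerC : forall x y : E, star (inner x y) = inner y x;
  hilb_inner_ge0 : forall x : E, cstar_ge0 (inner x x);
  hilb_inner_eq0 : forall x : E, inner x x = 0 -> x = 0;
  hilb_complete : forall u : nat -> E, hcauchy u -> exists l, hcvg u l
}.

Definition is_adjoint (E F : hmod A) (S : E -> F) (T : F -> E) : Prop :=
  forall x y, inner (S x) y = inner x (T y).

Definition unitary (E F : hmod A) (U : E -> F) : Prop :=
  exists V : F -> E, [/\ is_adjoint U V, cancel U V & cancel V U].

(* The last three axioms say that lact is a *-homomorphism into the            *)
(* adjointable operators.  Unitality of the left action is not required of a   *)
(* correspondence; it holds in the fibers of a product system.                 *)
Record is_correspondence (E : corr A) : Prop := IsCorrespondence {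
  corr_hilbert : is_hilbert E;
  corr_lactD : forall a b (x : E), lact (a + b) x = lact a x + lact b x;
  corr_lactZ : forall (c : R[i]) a (x : E), lact (c *: a) x = c *: lact a x;
  corr_lactM : forall a b (x : E), lact (a *c b) x = lact a (lact b x);
  corr_adjoint : forall a, is_adjoint (@lact R A E a) (@lact R A E (star a))
}.

Definition regular_corr : corr A :=
  Corr (corr_hmod := HMod (hmod_sort := A) (fun x a => x *c a)
                          (fun x y => star x *c y))
       (fun a x => a *c x).

Definition is_corr_iso (E F : corr A) (f : E -> F) : Prop :=
  [/\ bijective f, linear f,
      (forall x y, inner (f x) (f y) = inner x y),
      (forall x a, f (ract x a) = ract (f x) a)
    & (forall a x, f (lact a x) = lact a (f x))].

(* T is the interior tensor product of E and F over A, with elementary tensors *)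
(* t x y: the Hausdorff completion of the algebraic A-balanced tensor product  *)
(* for the A-valued form <x (x) y, x' (x) y'> = <y, <x, x'> y'>.  This         *)
(* determines (T, t) up to a unique unitary.                                   *)
Record is_interior_tensor (E : hmod A) (F : corr A) (T : hmod A)
    (t : E -> F -> T) : Prop := IsInteriorTensor {
  itens_hilbert : is_hilbert T;
  itens_linearl : forall y, linear (fun x => t x y);
  itens_linearr : forall x, linear (t x);
  itens_balanced : forall x a y, t (ract x a) y = t x (lact a y);
  itens_ract : forall x y a, ract (t x y) a = t x (ract y a);
  itens_inner : forall x y x' y',
    inner (t x y) (t x' y') = inner y (lact (inner x x') y');
  itens_dense : forall (z : T) (e : R[i]), 0 < e ->
    exists s : seq (E * F), hnorm (z - \sum_(u <- s) t u.1 u.2) < e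
}.

(* m : E x F -> H extends to a unitary from the interior tensor product onto H. *)
(* Since the latter is only determined up to a unitary, the requirement is      *)
(* that it exists and that m extends to every model of it.                      *)
Definition extends_to_unitary (E : hmod A) (F : corr A) (H : hmod A)
    (m : E -> F -> H) : Prop :=
  (exists (T : hmod A) (t : E -> F -> T), is_interior_tensor t) /\
  (forall (T : hmod A) (t : E -> F -> T), is_interior_tensor t ->
     exists U : T -> H, unitary U /\ forall x y, U (t x y) = m x y).

End Modules.

(* ps_coef is the identification of A with the fiber at the identity. *)
Record psData (R : realType) (A : cstarAlgType R) (S : monoidType) := PSData {
  ps_fiber :> S -> corr A;
  ps_mul : forall p q : S, ps_fiber p -> ps_fiber q -> ps_fiber (p * q)%g;
  ps_coef : A -> ps_fiber 1%g
}.

Section ProductSystem.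
Variables (R : realType) (A : cstarAlgType R) (S : monoidType).
Variable X : psData A S.

(* Identities between elements of X_p and X_q, where p = q holds only          *)
(* propositionally, are stated in the disjoint union of the fibers.            *)
Definition ps_total : Type := {p : S & X p}.

Definition ps_in (p : S) (x : X p) : ps_total := existT (fun q => X q) p x.

Definition ps_tmul (u v : ps_total) : ps_total :=
  ps_in (ps_mul (projT2 u) (projT2 v)).

Record is_product_system : Prop := IsProductSystem {
  ps_corr : forall p, is_correspondence (X p);
  ps_assoc : associative ps_tmul;
  ps_unit : is_corr_iso (E := regular_corr A) (@ps_coef R A S X);
  ps_unitary : forall p q, extends_to_unitary (@ps_mul R A S X p q);
  ps_lactE : forall p (x : X p) a,
    ps_tmul (ps_in (ps_coef X a)) (ps_in x) = ps_in (lact a x);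
  ps_ractE : forall p (x : X p) a,
    ps_tmul (ps_in x) (ps_in (ps_coef X a)) = ps_in (ract x a)
}.

End ProductSystem.

(* zs_act g p is g . p and zs_res p g is g|_p. *)
Record zappaSzep (P : monoidType) (G : groupType) := ZappaSzep {
  zs_act : G -> P -> P;
  zs_res : P -> G -> G;
  zs_act1 : forall p, zs_act 1%g p = p;
  zs_actM : forall g h p, zs_act (g * h)%g p = zs_act g (zs_act h p);
  zs_act_1 : forall g, zs_act g 1%g = 1%g;
  zs_res_1 : forall g, zs_res 1%g g = g;
  zs_act_M : forall g p q,
    zs_act g (p * q)%g = (zs_act g p * zs_act (zs_res p g) q)%g;
  zs_res_M : forall g p q, zs_res (p * q)%g g = zs_res q (zs_res p g);
  zs_res1 : forall p, zs_res p 1%g = 1%g;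
  zs_resM : forall g h p,
    zs_res p (g * h)%g = (zs_res (zs_act h p) g * zs_res p h)%g
}.

Definition zs_prod (P : monoidType) (G : groupType) (Z : zappaSzep P G) : Type :=
  (P * G)%type.

Section ZSProduct.
Variables (P : monoidType) (G : groupType) (Z : zappaSzep P G).
Implicit Types s t u : zs_prod Z.

Definition zs_mul s t : zs_prod Z :=
  ((s.1 * zs_act Z s.2 t.1)%g, (zs_res Z t.1 s.2 * t.2)%g).

Definition zs_one : zs_prod Z := (1%g, 1%g).

Lemma zs_mulA : associative zs_mul.
Proof.
move=> [p g] [q h] [r k]; congr pair => /=.
  by rewrite zs_act_M zs_actM mulgA.
by rewrite zs_res_M zs_resM mulgA.
Qed.

Lemma zs_mul1 : left_id zs_one zs_mul.
Proof. by move=> [p g]; rewrite /zs_mul /= zs_act1 zs_res1 !mul1g. Qed.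

Lemma zs_mulr1 : right_id zs_one zs_mul.
Proof. by move=> [p g]; rewrite /zs_mul /= zs_act_1 zs_res_1 !mulg1. Qed.

HB.instance Definition _ := Choice.copy (zs_prod Z) (P * G)%type.
HB.instance Definition _ :=
  isMonoid.Build (zs_prod Z) zs_mulA zs_mul1 zs_mulr1.

End ZSProduct.

(* zsa_map g p is the restriction X_p -> X_(g . p) of beta_g, and zsa_coef g   *)
(* is its restriction to X_e read on A through the identification ps_coef      *)
(* (see zsa_coefE).                                                            *)
Record zsActionData (R : realType) (A : cstarAlgType R) (P : monoidType)
    (G : groupType) (Z : zappaSzep P G) (X : psData A P) := ZSActionData {
  zsa_map : forall (g : G) (p : P), X p -> X (zs_act Z g p);
  zsa_coef : G -> A -> A
}.

Section ZSAction.
Variables (R : realType) (A : cstarAlgType R) (P : monoidType) (G : groupType).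
Variables (Z : zappaSzep P G) (X : psData A P) (beta : zsActionData Z X).

Definition zsa_tmap (g : G) (u : ps_total X) : ps_total X :=
  ps_in (zsa_map beta g (projT2 u)).

Record is_zs_action : Prop := IsZSAction {
  zsa_linear : forall g p, linear (@zsa_map R A P G Z X beta g p);
  zsa_comp : forall g h u, zsa_tmap g (zsa_tmap h u) = zsa_tmap (g * h)%g u;
  zsa_one : forall u, zsa_tmap 1%g u = u;
  zsa_coefE : forall g a,
    zsa_tmap g (ps_in (ps_coef X a)) = ps_in (ps_coef X (zsa_coef beta g a));
  zsa_auto : forall g, star_automorphism (zsa_coef beta g);
  zsa_mul : forall g p q (x : X p) (y : X q),
    zsa_tmap g (ps_tmul (ps_in x) (ps_in y)) =
    ps_tmul (zsa_tmap g (ps_in x)) (zsa_tmap (zs_res Z p g) (ps_in y));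
  zsa_inner : forall g p (x y : X p),
    inner (zsa_map beta g x) (zsa_map beta g y) =
    zsa_coef beta (zs_res Z p g) (inner x y)
}.

(* The fiber at (p, g), with x (x) g represented by x : X p. *)
Definition zs_fiber (s : zs_prod Z) : corr A :=
  Corr (corr_hmod := HMod (hmod_sort := X s.1)
          (fun x a => ract x (zsa_coef beta s.2 a))
          (fun x y => zsa_coef beta (s.2)^-1%g (inner x y)))
       (fun a x => lact a x).

Definition zs_system : psData A (zs_prod Z) :=
  @PSData R A (zs_prod Z) zs_fiber
    (fun s t x y => ps_mul (p := s.1) (q := zs_act Z s.2 t.1)
                           x (zsa_map beta s.2 (p := t.1) y))
    (ps_coef X).

End ZSAction.

(* Main.v *)
(** Everything except the unitarity of the multiplication is a computation from
the axioms: the fiber over (p, g) is X_p with its right action and inner product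
twisted by beta_g, and beta_g maps the fiber over (q, h) onto X_(g . q).  Both
maps are isomorphisms of Hilbert modules up to an automorphism of A, and they
turn the multiplication of Y into that of X.  A model of the tensor product of
two fibers of Y becomes, after twisting by that automorphism, a model of the
tensor product of fibers of X, to which the unitarity assumed for X applies.

Completeness and density survive twisting because a *-automorphism g of A is
bounded on self-adjoint elements.  To see this without spectral theory, let h be
self-adjoint with |h| <= 1/2.  The contraction y |-> (h^2 + y^2)/2 has a fixed
point l, which by uniqueness is self-adjoint and commutes with h, and
u = h + i (1 - l) is unitary because (1 - l)^2 = 1 - h^2.  Hence g(u) is
unitary, and g(h) = (g(u) + g(u)^* )/2 has norm at most 1. *)

Require Import Defs.
From Stdlib Require Eqdep_dec.
From mathcomp Require Import all_boot all_order all_algebra.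
From mathcomp Require Import complex.
From mathcomp Require Import all_classical all_reals all_analysis.

Set Implicit Arguments.
Unset Strict Implicit.
Unset Printing Implicit Defensive.

Import Order.TTheory GRing.Theory Num.Theory.
Import numFieldNormedType.Exports.

Local Open Scope classical_set_scope.
Local Open Scope ring_scope.

(** * Preliminaries: linear maps, and limits over complex scalars *)

Lemma linear_morphs (K : pzRingType) (U V : lmodType K) (f : U -> V) :
  linear f -> [/\ f 0 = 0, {morph f : x y / x + y}, {morph f : x y / x - y}
    & forall z, {morph f : x / z *: x}].
Proof.
move=> fl; have fD : {morph f : x y / x + y}.
  by move=> x y; rewrite -[x]scale1r fl !scale1r.
have f0 : f 0 = 0 by apply: (addrI (f 0)); rewrite -fD !addr0.
have fZ z : {morph f : x / z *: x}.
  by move=> x; rewrite -[z *: x]addr0 fl f0 addr0.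
by split=> // x y; rewrite fD -scaleN1r fZ scaleN1r.
Qed.

Lemma complex_half_exp_lt (R : realType) (e : R[i]) :
  0 < e -> exists n, 2^-1 ^+ n < e.
Proof.
case: e => r s; rewrite ltcE /= => /andP[/eqP -> r0].
(* A positive complex number is a real [r > 0], and [n > 1/r] gives [2^n > n > 1/r]. *)
exists (Num.Def.archi_bound r^-1).
have -> : (2^-1 : R[i]) = (2^-1)%:C%C by rewrite fmorphV rmorph_nat.
rewrite -rmorphXn /= ltcE /= eqxx /= exprVn invf_plt ?posrE ?exprn_gt0 //.
apply: (lt_trans (archi_boundP _)); first by rewrite invr_ge0 ltW.
by rewrite -natrX ltr_nat ltn_expl.
Qed.

Lemma norm_eq0_of_half (K : numFieldType) (V : normedModType K) (x : V) :
  `|x| <= 2^-1 * `|x| -> x = 0.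
Proof.
rewrite -subr_ge0 -{2}[`|x|]mul1r -mulrBl => h.
apply/eqP; rewrite -normr_eq0 eq_le normr_ge0 andbT.
rewrite -(@ler_nM2l _ (2^-1 - 1)) ?mulr0 //.
by rewrite subr_lt0 invf_lt1 // ltr1n.
Qed.

Lemma eq_of_dist_small (K : numFieldType) (V : normedModType K) (x y : V) :
  (forall e : K, 0 < e -> `|x - y| <= e) -> x = y.
Proof.
move=> xy; apply/eqP; rewrite -subr_eq0; apply/negPn/negP => nz.
have /xy le : 0 < 2^-1 * `|x - y| by rewrite mulr_gt0 ?invr_gt0 ?normr_gt0.
by rewrite (norm_eq0_of_half le) eqxx in nz.
Qed.

(* banach_fixed_point and the library's geometric series need real scalars. *)
Lemma cvg_of_half_exp (R : realType) (V : completeNormedModType R[i])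
    (u : nat -> V) :
  (forall n, `|u n.+1 - u n| <= 2^-1 ^+ n) ->
  exists l, forall e : R[i],
    0 < e -> exists n, `|l - u n| < e /\ `|l - u n.+1| < e.
Proof.
move=> du.
(* The bound is the sum of [2^-i] for [m <= i < m + k], in closed form so that the induction
   telescopes. *)
have dist m k : `|u (m + k)%N - u m| <= 2 * (2^-1 ^+ m - 2^-1 ^+ (m + k)).
  elim: k => [|k IH]; first by rewrite addn0 !subrr normr0 mulr0.
  rewrite addnS -(subrK (u (m + k)%N) (u _.+1)) -addrA.
  apply: le_trans (ler_normD _ _) _; apply: le_trans (lerD (du _) IH) _.
  rewrite exprS !mulrBr mulrA mulfV ?pnatr_eq0 // mul1r.
  by rewrite [2 * _ ^+ (m + k)]mulr_natl mulr2n opprD addrCA addNKr.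
have dist' m n : (m <= n)%N -> `|u m - u n| <= 2 * 2^-1 ^+ m.
  move=> mn; rewrite distrC -(subnKC mn); apply: le_trans (dist _ _) _.
  by rewrite ler_pM2l // gerBl exprn_ge0 // invr_ge0.
have cu : cvg (u n @[n --> \oo]).
  apply/cauchy_cvgP/cauchy_ballP => e e0.
  (* The tolerance is [e / 4] because two terms beyond [N] each lie within [2 * 2^-N] of [u N]. *)
  have [N Ne] := complex_half_exp_lt (divr_gt0 e0 (ltr0Sn _ 3)).
  pose B := u @` [set n | (N <= n)%N].
  exists (B, B); first by split; exists N => // n Nn; exists n.
  move=> [_ _] /= [[n Nn <-] [m Nm <-]]; rewrite -ball_normE /=.
  rewrite -(subrK (u N) (u n)) -addrA.
  apply: le_lt_trans (ler_normD _ _) _; rewrite distrC.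
  apply: le_lt_trans (lerD (dist' _ _ Nn) (dist' _ _ Nm)) _.
  by rewrite -mulrDl -natrD -ltr_pdivlMl // mulrC.
exists (lim (u n @[n --> \oo])) => e e0.
have /cvgrPdist_lt /(_ e e0) [N _ HN] := cu.
by exists N; split; apply: HN => /=.
Qed.

(** * C*-algebras: boundedness of *-automorphisms on self-adjoint elements *)

Section CStarAlgebra.
Variables (R : realType) (A : cstarAlgType R).
Implicit Types a b c h l u x : A.

Lemma cmulNl a b : (- a) *c b = - (a *c b).
Proof. by rewrite -scaleN1r cmulZl scaleN1r. Qed.

Lemma cmulNr a b : a *c (- b) = - (a *c b).
Proof. by rewrite -scaleN1r cmulZr scaleN1r. Qed.

Lemma cmulBl a b c : (a - b) *c c = a *c c - b *c c.
Proof. by rewrite cmulDl cmulNl. Qed.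

Lemma cmulBr a b c : a *c (b - c) = a *c b - a *c c.
Proof. by rewrite cmulDr cmulNr. Qed.

Lemma starB a b : star (a - b) = star a - star b.
Proof. by rewrite starD -scaleN1r starZ rmorphN1 scaleN1r. Qed.

Lemma star1 : star cone = cone :> A.
Proof. by rewrite -[LHS]cmul1 -{1}[cone]starK -starM cmul1 starK. Qed.

Lemma starZ_ge0 (c : R[i]) a : 0 <= c -> star (c *: a) = c *: star a.
Proof.
by move=> c0; rewrite starZ; congr (_ *: _); apply/conj_Creal/ger0_real.
Qed.

(** The C*-identity and submultiplicativity give [|b|^2 <= |star b| |b|]; cancel [|b|], then
    exchange [b] and [star b]. *)
Lemma norm_star a : `|star a| = `|a|.
Proof.
suff le b : `|b| <= `|star b| by apply/eqP; rewrite eq_le le -{2}[a]starK le.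
have [->|b0] := eqVneq b 0; first by rewrite normr0.
have := cnorm_mul (star b) b.
by rewrite cnorm_star expr2 ler_pM2r // normr_gt0.
Qed.

(** By the C*-identity the norm of the unit equals its own square, so it is 0 (in the zero algebra)
    or 1. *)
Lemma norm_cone_le1 : `|cone : A| <= 1.
Proof.
have := cnorm_star (cone : A); rewrite star1 cmul1 expr2.
have [->|n0] := eqVneq `|cone : A| 0 => // /esym /eqP.
rewrite -subr_eq0 -{3}[`|_|]mul1r -mulrBl mulf_eq0 (negPf n0) orbF.
by rewrite subr_eq0 => /eqP ->.
Qed.

Lemma norm_sqrB_le a b (r : R[i]) : `|a| <= r -> `|b| <= r ->
  `|a *c a - b *c b| <= (r + r) * `|a - b|.
Proof.
move=> ar br.
have -> : a *c a - b *c b = a *c (a - b) + (a - b) *c b.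
  by rewrite cmulBr cmulBl addrA subrK.
apply: le_trans (ler_normD _ _) _; rewrite mulrDl; apply: lerD.
  by apply: le_trans (cnorm_mul _ _) _; rewrite ler_wpM2r.
by apply: le_trans (cnorm_mul _ _) _; rewrite mulrC ler_wpM2r.
Qed.

Let T (x a : A) := 2^-1 *: (x + a *c a).

Lemma normT_le x a :
  `|x| <= 2^-1 :> R[i] -> `|a| <= 2^-1 :> R[i] -> `|T x a| <= 2^-1 :> R[i].
Proof.
move=> xh ah; rewrite normrZ ger0_norm ?invr_ge0 //.
rewrite -[leRHS]mulr1 ler_pM2l ?invr_gt0 //.
rewrite [leRHS](splitr 1) mul1r; apply: le_trans (ler_normD _ _) _.
apply: lerD => //; apply: le_trans (cnorm_mul _ _) _.
apply: le_trans (ler_pM (normr_ge0 _) (normr_ge0 _) ah ah) _.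
by rewrite ger_pMl ?invr_gt0 // invf_le1 // ler1n.
Qed.

(** Squaring is 1-Lipschitz on the ball of radius 1/2, so the factor 1/2 in [T] makes it a
    contraction there. *)
Lemma norm_TB_le x a b : `|a| <= 2^-1 :> R[i] -> `|b| <= 2^-1 :> R[i] ->
  `|T x a - T x b| <= 2^-1 * `|a - b|.
Proof.
move=> ah bh; rewrite /T -scalerBr opprD addrACA subrr add0r normrZ.
rewrite ger0_norm ?invr_ge0 // ler_pM2l ?invr_gt0 //.
apply: le_trans (norm_sqrB_le ah bh) _.
by rewrite -[2^-1]mul1r -splitr mul1r.
Qed.

(** Picard iteration of [T x] from 0, which stays in the ball of radius 1/2. *)
Lemma half_sqr_fixpoint x : `|x| <= 2^-1 :> R[i] ->
  exists l, `|l| <= 2^-1 :> R[i] /\ l = 2^-1 *: (x + l *c l).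
Proof.
move=> xh; pose u n := iter n (T x) 0.
have uh n : `|u n| <= 2^-1 :> R[i].
  by elim: n => [|n IH]; rewrite /= ?normr0 ?invr_ge0 //; apply: normT_le.
have [n|l lu] := @cvg_of_half_exp R A u.
  elim: n => [|n IH].
    by rewrite subr0 expr0 (le_trans (uh 1%N)) // invf_le1 // ler1n.
  apply: (le_trans (norm_TB_le x (uh n.+1) (uh n))).
  by rewrite exprS ler_pM2l ?invr_gt0.
have lh : `|l| <= 2^-1 :> R[i].
  apply/ler_addgt0Pr => e /lu [n [ln _]].
  rewrite -(subrK (u n) l) [leRHS]addrC; apply: le_trans (ler_normD _ _) _.
  by apply: lerD; [exact: ltW | exact: uh].
exists l; split=> //; apply: eq_of_dist_small => e e0.
have e20 : 0 < e / 2 by rewrite divr_gt0.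
have [n [ln lSn]] := lu _ e20.
apply: le_trans (ler_distD (u n.+1) _ _) _.
rewrite [leRHS](splitr e); apply: lerD; first exact: ltW.
rewrite distrC; apply: (le_trans (norm_TB_le x lh (uh n))).
by apply: le_trans (ltW ln); rewrite ler_piMl // invf_le1 // ler1n.
Qed.

Lemma half_sqr_fixpoint_unique x a b :
  `|a| <= 2^-1 :> R[i] -> `|b| <= 2^-1 :> R[i] ->
  a = 2^-1 *: (x + a *c a) -> b = 2^-1 *: (x + b *c b) -> a = b.
Proof.
move=> ah bh aE bE; apply/subr0_eq/norm_eq0_of_half.
by rewrite {1}aE {1}bE; apply: norm_TB_le.
Qed.

(** Since [h] commutes with [h^2], the commutator [d] of [h] and [l] satisfies [d = (d l + l d)/2],
    whence [|d| <= |d|/2]. *)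
Lemma half_sqr_fixpoint_comm h l : `|l| <= 2^-1 :> R[i] ->
  l = 2^-1 *: (h *c h + l *c l) -> h *c l = l *c h.
Proof.
move=> lh lE; apply/subr0_eq/norm_eq0_of_half; set d := h *c l - l *c h.
have dE : d = 2^-1 *: (d *c l + l *c d).
  rewrite {1}/d {1 2}lE cmulZr cmulZl -scalerBr cmulDr cmulDl !cmulA.
  rewrite opprD addrACA subrr add0r /d cmulBl cmulBr !cmulA addrA.
  by rewrite subrK.
rewrite {1}dE normrZ ger0_norm ?invr_ge0 // ler_pM2l ?invr_gt0 //.
apply: le_trans (ler_normD _ _) _; rewrite [leRHS]splitr.
apply: lerD; apply: le_trans (cnorm_mul _ _) _.
  exact: (ler_wpM2l (normr_ge0 _) lh).
by rewrite mulrC; apply: (ler_wpM2l (normr_ge0 _) lh).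
Qed.

Lemma self_adjoint_unitary_part h : star h = h -> `|h| <= 2^-1 :> R[i] ->
  exists u, star u *c u = cone /\ u + star u = 2 *: h.
Proof.
move=> hs hh.
have xh : `|h *c h| <= 2^-1 :> R[i].
  apply: le_trans (cnorm_mul _ _) _.
  apply: le_trans (ler_pM (normr_ge0 _) (normr_ge0 _) hh hh) _.
  by rewrite ger_pMl ?invr_gt0 // invf_le1 // ler1n.
have [l [lh lE]] := half_sqr_fixpoint xh.
have ls : star l = l.
  apply: (half_sqr_fixpoint_unique _ lh _ lE); first by rewrite norm_star.
  by rewrite {1}lE starZ_ge0 ?invr_ge0 // starD !starM hs.
have hl := half_sqr_fixpoint_comm lh lE.
(* [b] serves as a square root of [1 - h^2]: the fixed-point equation reads [2 l = h^2 + l^2]. *)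
pose b := cone - l.
have bs : star b = b by rewrite /b starB star1 ls.
have hb : h *c b = b *c h by rewrite /b cmulBr cmulBl hl cmul1 cmulr1.
have bb : h *c h + b *c b = cone.
  have ll : l + l = h *c h + l *c l.
    by rewrite -mulr2n -scaler_nat {1}lE scalerA mulfV ?scale1r ?pnatr_eq0.
  rewrite /b cmulBr cmulr1 cmulBl cmul1 opprB addrACA -opprD ll opprD.
  by rewrite addrACA subrr addr0 addrCA subrr addr0.
exists (h + 'i *: b); rewrite starD starZ hs bs conjCi scaleNr; split.
  rewrite cmulBl !cmulDr !cmulZl !cmulZr hb opprD addrACA scalerA -expr2 sqrCi.
  by rewrite scaleN1r opprK addrA subrK bb.
by rewrite addrACA subrr addr0 -mulr2n scaler_nat.
Qed.

Lemma star_automorphism_norm_le (f : A -> A) h : star_automorphism f ->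
  star h = h -> `|f h| <= 2 * `|h|.
Proof.
move=> [_ fl f1 fM fs] hs.
have [f0 fD _ fZ] := linear_morphs fl.
have small k : star k = k -> `|k| <= 2^-1 :> R[i] -> `|f k| <= 1 :> R[i].
  move=> ks /(self_adjoint_unitary_part ks) [u [uu uk]].
  have fu : `|f u| <= 1 :> R[i].
    rewrite -(@expr_le1 _ 2) // -cnorm_star -fs -fM uu f1; exact: norm_cone_le1.
  have -> : f k = 2^-1 *: (f u + star (f u)).
    by rewrite -fs -fD uk fZ scalerA mulVf ?scale1r ?pnatr_eq0.
  rewrite normrZ ger0_norm ?invr_ge0 // mulrC ler_pdivrMr // mul1r.
  by apply: le_trans (ler_normD _ _) _; rewrite norm_star [leRHS]mulr2n lerD.
have [->|h0] := eqVneq h 0; first by rewrite f0 !normr0 mulr0.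
(* Rescaling [h] to norm 1/2, the radius allowed in [small], produces the factor 2. *)
pose r : R[i] := (2 * `|h|)^-1.
have r0 : 0 < r by rewrite invr_gt0 mulr_gt0 ?normr_gt0.
have := small (r *: h).
rewrite fZ !normrZ (gtr0_norm r0) (starZ_ge0 _ (ltW r0)) hs.
have -> : r * `|h| = 2^-1 by rewrite /r invfM -mulrA mulVf ?mulr1 ?normr_eq0.
move=> /(_ erefl (lexx _)).
by rewrite /r ler_pdivrMl ?mulr1 ?mulr_gt0 ?normr_gt0.
Qed.

End CStarAlgebra.

(** * Hilbert modules and tensor products transported along automorphisms of the coefficients *)

Section HilbertModules.
Variables (R : realType) (A : cstarAlgType R).

Lemma star_automorphism_inv (g g' : A -> A) :
  cancel g g' -> cancel g' g -> star_automorphism g -> star_automorphism g'.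
Proof.
move=> gK g'K [_ gl g1 gM gs]; have gI := can_inj gK; split.
- by exists g.
- by move=> z a b; apply: gI; rewrite gl !g'K.
- by apply: gI; rewrite g'K g1.
- by move=> a b; apply: gI; rewrite gM !g'K.
- by move=> a; apply: gI; rewrite gs !g'K.
Qed.

(** One notion covers both the identity from a twisted fiber to [X_p] and the maps [beta_g] between
    fibers. *)
Definition hmod_iso_over (g : A -> A) (E F : hmod A) (f : E -> F) : Prop :=
  [/\ bijective f, linear f, (forall x a, f (ract x a) = ract (f x) (g a))
    & (forall x y, inner (f x) (f y) = g (inner x y))].

Lemma hmod_iso_over_inv (g g' : A -> A) (E F : hmod A) (f : E -> F)
    (k : F -> E) :
  cancel g g' -> cancel g' g -> cancel f k -> cancel k f ->
  hmod_iso_over g f -> hmod_iso_over g' k.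
Proof.
move=> gK g'K fK kK [_ fl fr fi]; have fI := can_inj fK; split.
- by exists f.
- by move=> z x y; apply: fI; rewrite fl !kK.
- by move=> x a; apply: fI; rewrite fr !kK g'K.
- by move=> x y; apply: (can_inj gK); rewrite -fi !kK g'K.
Qed.

(** The factor is the square root of the bound for [g] on self-adjoint elements. Self-adjointness of
    [inner x x] is a hypothesis so that the lemma applies before [E] is known to be a Hilbert
    module. *)
Lemma hnorm_iso_over_le (g : A -> A) (E F : hmod A) (f : E -> F) (x : E) :
  star_automorphism g -> hmod_iso_over g f ->
  star (inner x x) = inner x x -> hnorm (f x) <= sqrtC 2 * hnorm x.
Proof.
move=> Hg [_ _ _ fi] xs; rewrite /hnorm fi -rootCMl //.
by rewrite ler_rootC ?qualifE /= ?mulr_ge0 // star_automorphism_norm_le.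
Qed.

Lemma is_hilbert_iso_over (g : A -> A) (E F : hmod A) (f : E -> F) :
  star_automorphism g -> hmod_iso_over g f -> is_hilbert F -> is_hilbert E.
Proof.
move=> Hg Hf HF; have [[g' gK g'K] gl g1 gM gs] := Hg.
have [[k fK kK] fl fr fi] := Hf.
have Hg' := star_automorphism_inv gK g'K Hg.
have Hk := hmod_iso_over_inv gK g'K fK kK Hf.
have gI := can_inj gK; have fI := can_inj fK.
have [f0 fD fB fZ] := linear_morphs fl; have [g0 gD _ gZ] := linear_morphs gl.
have Es (x y : E) : star (inner x y) = inner y x.
  by apply: gI; rewrite gs -!fi hilb_innerC.
split.
- by move=> x y a; apply: fI; rewrite fD !fr fD hilb_ractDl.
- by move=> x a b; apply: fI; rewrite fD !fr gD hilb_ractDr.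
- by move=> z x a; apply: fI; rewrite fZ !fr fZ hilb_ractZl.
- by move=> z x a; apply: fI; rewrite fZ !fr gZ hilb_ractZr.
- by move=> x a b; apply: fI; rewrite !fr gM hilb_ractM.
- by move=> x; apply: fI; rewrite fr g1 hilb_ract1.
- by move=> x y z; apply: gI; rewrite gD -!fi fD hilb_innerD.
- by move=> z x y; apply: gI; rewrite gZ -!fi fZ hilb_innerZ.
- by move=> x y a; apply: gI; rewrite gM -!fi fr hilb_innerA.
- exact: Es.
- move=> x; have [b bE] := hilb_inner_ge0 HF (f x).
  by exists (g' b); apply: gI; rewrite gM gs g'K -fi.
- move=> x x0; apply: fI; rewrite f0; apply: (hilb_inner_eq0 HF).
  by rewrite fi x0.
(* Completeness: the bound for [g] makes [f \o u] Cauchy in [F], and the bound for [g'] carries its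
   limit back to [E]. *)
move=> u uC; have C0 : 0 < sqrtC 2 :> R[i] by rewrite sqrtC_gt0.
have [e e0|l lu] := hilb_complete HF (u := f \o u).
  have [N HN] := uC _ (divr_gt0 e0 C0).
  exists N => m n Nm Nn; rewrite /= -fB.
  apply: (le_lt_trans (hnorm_iso_over_le Hg Hf (Es _ _))).
  by rewrite mulrC -ltr_pdivlMr ?HN.
exists (k l) => e e0; have [N HN] := lu _ (divr_gt0 e0 C0).
exists N => n Nn; rewrite -(fK (u n - k l)) fB kK.
apply: (le_lt_trans (hnorm_iso_over_le Hg' Hk (hilb_innerC HF _ _))).
by rewrite mulrC -ltr_pdivlMr ?HN.
Qed.

(** Two automorphisms occur: [g] acts on the coefficients balanced between the factors (right on
    [E], left on [F]), while [d] acts on those of the right module structure shared by [F] and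
    [T]. *)
Lemma is_interior_tensor_iso_over (g d : A -> A) (E E' : hmod A)
    (F F' : corr A) (T T' : hmod A) (e : E' -> E) (f : F' -> F) (c : T' -> T)
    (t : E -> F -> T) (t' : E' -> F' -> T') :
  star_automorphism d ->
  hmod_iso_over g e -> hmod_iso_over d f -> hmod_iso_over d c ->
  (forall a y, f (lact a y) = lact (g a) (f y)) ->
  (forall x y, c (t' x y) = t (e x) (f y)) ->
  is_interior_tensor t -> is_interior_tensor t'.
Proof.
move=> Hd He Hf Hc fl' ct Ht.
have [[d' dK d'K] _ _ _ _] := Hd; have [[e' eK e'K] el er ei] := He.
have [[f' fK f'K] fl fr fi] := Hf; have [[c' cK c'K] cl cr ci] := Hc.
have cI := can_inj cK; have dI := can_inj dK.
have [c0 cD cB _] := linear_morphs cl.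
have HT := itens_hilbert Ht.
split.
- exact: is_hilbert_iso_over Hd Hc HT.
- by move=> y z x1 x2; apply: cI; rewrite cl !ct el (itens_linearl Ht).
- by move=> x z y1 y2; apply: cI; rewrite cl !ct fl (itens_linearr Ht).
- by move=> x a y; apply: cI; rewrite !ct er (itens_balanced Ht) fl'.
- by move=> x y a; apply: cI; rewrite cr !ct (itens_ract Ht) fr.
- by move=> x y x' y'; apply: dI; rewrite -ci !ct (itens_inner Ht) ei -fl' fi.
move=> z r r0; have C0 : 0 < sqrtC 2 :> R[i] by rewrite sqrtC_gt0.
have [s Hs] := itens_dense Ht (c z) (divr_gt0 r0 C0).
exists [seq (e' u.1, f' u.2) | u <- s].
have Hd' := star_automorphism_inv dK d'K Hd.
have Hc' := hmod_iso_over_inv dK d'K cK c'K Hc.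
rewrite -(cK (z - _)) cB big_map.
have -> : c (\sum_(u <- s) t' (e' u.1) (f' u.2)) = \sum_(u <- s) t u.1 u.2.
  rewrite (big_morph c cD c0); apply: eq_bigr => u _.
  by rewrite ct e'K f'K.
apply: (le_lt_trans (hnorm_iso_over_le Hd' Hc' (hilb_innerC HT _ _))).
by rewrite mulrC -ltr_pdivlMr.
Qed.

Lemma unitary_iso_over (g : A -> A) (E E' F F' : hmod A)
    (e : E -> E') (f : F -> F') (U : E -> F) (V : E' -> F') :
  hmod_iso_over g e -> hmod_iso_over g f -> (forall x, V (e x) = f (U x)) ->
  unitary U -> unitary V.
Proof.
move=> [[e' eK e'K] _ _ ei] [[f' fK f'K] _ _ fi] Ve [W [UW UK WK]].
exists (e \o W \o f'); split.
- by move=> x y; rewrite -(e'K x) -(f'K y) Ve fi UW /= fK -ei.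
- by move=> x; rewrite -(e'K x) Ve /= fK UK.
- by move=> y; rewrite /= Ve WK f'K.
Qed.

Definition hmod_twist (E : hmod A) (g g' : A -> A) : hmod A :=
  HMod (hmod_sort := E) (fun x a => ract x (g a)) (fun x y => g' (inner x y)).

Lemma hmod_twist_iso (E : hmod A) (g g' : A -> A) : cancel g' g ->
  hmod_iso_over g (id : hmod_twist E g g' -> E).
Proof. by move=> g'K; split=> [|||x y] //=; exists id. Qed.

Lemma extends_to_unitary_iso_over (g d : A -> A) (E E' : hmod A)
    (F F' : corr A) (H H' : hmod A) (e : E' -> E) (f : F' -> F) (c : H' -> H)
    (m : E -> F -> H) (m' : E' -> F' -> H') :
  star_automorphism g -> star_automorphism d ->
  hmod_iso_over g e -> hmod_iso_over d f -> hmod_iso_over d c ->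
  (forall a y, f (lact a y) = lact (g a) (f y)) ->
  (forall x y, c (m' x y) = m (e x) (f y)) ->
  extends_to_unitary m -> extends_to_unitary m'.
Proof.
move=> [[g' gK g'K] _ _ _ _] Hd He Hf Hc fl cm [[T0 [t0 Ht0]] Hm].
have [[d' dK d'K] _ _ _ _] := Hd; have Hd' := star_automorphism_inv dK d'K Hd.
split.
  (* A model for the primed modules is a model for the others, twisted by [d]. *)
  exists (hmod_twist T0 d d'), (fun x y => t0 (e x) (f y)).
  exact: (is_interior_tensor_iso_over Hd He Hf (hmod_twist_iso T0 d'K)).
move=> T' t' Ht'.
have [[e' eK e'K] _ _ _] := He; have [[f' fK f'K] _ _ _] := Hf.
have [[c' cK c'K] _ _ _] := Hc.
have He' := hmod_iso_over_inv gK g'K eK e'K He.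
have Hf' := hmod_iso_over_inv dK d'K fK f'K Hf.
have Hc' := hmod_iso_over_inv dK d'K cK c'K Hc.
(* Conversely, an arbitrary model [T'] twisted by the inverse of [d] is a model for [E] and [F], to
   which the hypothesis on [m] applies. *)
pose T := hmod_twist T' d' d.
have HT : hmod_iso_over d' (id : T -> T') := hmod_twist_iso T' dK.
pose t x y : T := t' (e' x) (f' y).
have Ht : is_interior_tensor t.
  apply: (is_interior_tensor_iso_over Hd' He' Hf' HT _ _ Ht') => // a y.
  by apply: (can_inj fK); rewrite f'K fl f'K g'K.
have [U [HU Ut]] := Hm _ _ Ht.
exists (c' \o U); split; first exact: unitary_iso_over HT Hc' _ HU.
by move=> x y; rewrite /= -{1}(eK x) -{1}(fK y) Ut -cm cK.
Qed.

End HilbertModules.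

(** Equality on the index monoid is decidable, so dependent pairs over the same index have equal
    second components; identities in the disjoint union thus descend to a fiber. *)
Lemma ps_in_inj (R : realType) (A : cstarAlgType R) (S : monoidType)
    (X : psData A S) (p : S) : injective (@ps_in R A S X p).
Proof.
by move=> x y; apply: Eqdep_dec.inj_pair2_eq_dec; apply: eq_comparable.
Qed.

(** * The product system over the Zappa-Szép product *)

Section ZappaSzepProductSystem.
Variables (R : realType) (A : cstarAlgType R) (P : monoidType) (G : groupType).
Variables (Z : zappaSzep P G) (X : psData A P) (beta : zsActionData Z X).
Hypotheses (HX : is_product_system X) (Hbeta : is_zs_action beta).

Local Notation bA := (zsa_coef beta).
Local Notation Y := (zs_system beta).
Local Notation act := (zs_act Z).
Local Notation res := (zs_res Z).

Lemma ps_coef_bij : bijective (ps_coef X).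
Proof. by case: (ps_unit HX). Qed.

Lemma zsa_coefM g h a : bA (g * h)%g a = bA g (bA h a).
Proof.
apply: (bij_inj ps_coef_bij); apply: ps_in_inj.
by rewrite -!(zsa_coefE Hbeta) (zsa_comp Hbeta).
Qed.

Lemma zsa_coef1 a : bA 1%g a = a.
Proof.
apply: (bij_inj ps_coef_bij); apply: ps_in_inj.
by rewrite -(zsa_coefE Hbeta) (zsa_one Hbeta).
Qed.

Lemma zsa_coefVK g : cancel (bA g^-1%g) (bA g).
Proof. by move=> a; rewrite -zsa_coefM mulgV zsa_coef1. Qed.

Lemma zsa_lact g p a (x : X p) :
  zsa_map beta g (lact a x) = lact (bA g a) (zsa_map beta g x).
Proof.
apply: ps_in_inj; rewrite -[LHS]/(zsa_tmap beta g (ps_in _)) -(ps_lactE HX).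
by rewrite (zsa_mul Hbeta) (zsa_coefE Hbeta) zs_res_1 (ps_lactE HX).
Qed.

(** The right action is multiplication by an element of [X_e], so (A5) applies and restricts [g] to
    [g|_p] on the coefficient. *)
Lemma zsa_ract g p (x : X p) a :
  zsa_map beta g (ract x a) = ract (zsa_map beta g x) (bA (res p g) a).
Proof.
apply: ps_in_inj; rewrite -[LHS]/(zsa_tmap beta g (ps_in _)) -(ps_ractE HX).
by rewrite (zsa_mul Hbeta) (zsa_coefE Hbeta) (ps_ractE HX).
Qed.

Lemma zsa_map_bij g p : bijective (@zsa_map R A P G Z X beta g p).
Proof.
have fI : injective (@zsa_map R A P G Z X beta g p).
  move=> x y xy; apply: ps_in_inj.
  have VK u : zsa_tmap beta g^-1%g (zsa_tmap beta g u) = u.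
    by rewrite (zsa_comp Hbeta) mulVg (zsa_one Hbeta).
  by rewrite -(VK (ps_in x)) -(VK (ps_in y)) /zsa_tmap /= xy.
have surj y : exists x, @zsa_map R A P G Z X beta g p x = y.
  (* The preimage comes from [beta_(g^-1)], whose value lies over [g^-1 . (g . p)]; this index
     equals [p] only propositionally, hence the passage through the disjoint union. *)
  have [x xE] : exists x : X p, zsa_tmap beta g^-1%g (ps_in y) = ps_in x.
    set u := zsa_tmap _ _ _.
    have : projT1 u = p by rewrite /u /= -zs_actM mulVg zs_act1.
    by case: u => q x /= <-; exists x.
  exists x; apply: ps_in_inj; rewrite -[LHS]/(zsa_tmap beta g (ps_in x)) -xE.
  by rewrite (zsa_comp Hbeta) mulgV (zsa_one Hbeta).
have [k kK] := choice surj.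
by exists k => // x; apply: fI; rewrite kK.
Qed.

(** Separating the group element from the point of [X] reduces identities in [Y] to identities in
    the disjoint union of the [X_p]. *)
Definition zs_in (u : ps_total X) (g : G) : ps_total Y :=
  ps_in (X := Y) (p := (projT1 u, g)) (projT2 u).

Lemma zs_inE (w : ps_total Y) :
  w = zs_in (existT _ (projT1 w).1 (projT2 w)) (projT1 w).2.
Proof. by case: w => [[p g] x]. Qed.

Lemma zs_tmulE u g v h :
  ps_tmul (zs_in u g) (zs_in v h) =
  zs_in (ps_tmul u (zsa_tmap beta g v)) (res (projT1 v) g * h)%g.
Proof. by []. Qed.

Lemma zs_assoc : associative (@ps_tmul R A _ Y).
Proof.
move=> u v w; rewrite (zs_inE u) (zs_inE v) (zs_inE w).
move: (projT1 u).2 (existT _ (projT1 u).1 _) => g {}u.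
move: (projT1 v).2 (existT _ (projT1 v).1 _) => h {}v.
move: (projT1 w).2 (existT _ (projT1 w).1 _) => k {}w.
rewrite !zs_tmulE; congr zs_in; last first.
  by rewrite /= zs_res_M zs_resM mulgA.
by rewrite (zsa_mul Hbeta) (ps_assoc HX) -(zsa_comp Hbeta).
Qed.

Lemma zs_fiber_iso (s : zs_prod Z) :
  hmod_iso_over (bA s.2) (id : Y s -> X s.1).
Proof. exact: hmod_twist_iso (zsa_coefVK s.2). Qed.

(** The index [g|_q h] is the group component of [(p, g)(q, h)], so this map is semilinear along the
    same automorphism as the twist of the target fiber of the multiplication. *)
Lemma zs_fiber_map_iso g (t : zs_prod Z) :
  hmod_iso_over (bA (res t.1 g * t.2)%g)
    (zsa_map beta g (p := t.1) : Y t -> X (act g t.1)).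
Proof.
split; [exact: zsa_map_bij | exact: (zsa_linear Hbeta) | |].
  by move=> x a; rewrite zsa_ract zsa_coefM.
by move=> x y; rewrite (zsa_inner Hbeta) zsa_coefM /= zsa_coefVK.
Qed.

Lemma zs_corr (s : zs_prod Z) : is_correspondence (Y s).
Proof.
have HXs := ps_corr HX s.1; split.
- exact: is_hilbert_iso_over (zsa_auto Hbeta s.2) (zs_fiber_iso s)
    (corr_hilbert HXs).
- exact: (corr_lactD HXs).
- exact: (corr_lactZ HXs).
- exact: (corr_lactM HXs).
- by move=> a x y; rewrite /= (corr_adjoint HXs).
Qed.

Lemma zs_unitary (s t : zs_prod Z) : extends_to_unitary (@ps_mul R A _ Y s t).
Proof.
(* The multiplication of [Y] is by definition that of [X] after [beta_g] on the second factor; only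
   compatibility with the left action remains. *)
apply: (extends_to_unitary_iso_over (zsa_auto Hbeta s.2) (zsa_auto Hbeta _)
  (zs_fiber_iso s) (zs_fiber_map_iso s.2 t) (zs_fiber_iso (s * t)%g) _ _
  (ps_unitary HX s.1 (act s.2 t.1))) => // a y.
exact: zsa_lact.
Qed.

(** Over [(e, e)] the twist is by [beta_e], the identity. *)
Lemma zs_unit : is_corr_iso (E := regular_corr A) (@ps_coef R A _ Y).
Proof.
have [cb cl ci cr cL] := ps_unit HX; split=> //.
- by move=> x y; rewrite /= invg1 zsa_coef1 ci.
- by move=> x a; rewrite /= zsa_coef1 cr.
Qed.

Lemma zs_lactE (s : zs_prod Z) (x : Y s) a :
  ps_tmul (ps_in (ps_coef Y a)) (ps_in x) = ps_in (lact a x).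
Proof.
case: s x => p g x.
rewrite -[LHS]/(ps_tmul (zs_in (ps_in (ps_coef X a)) 1%g)
                        (zs_in (ps_in (X := X) (p := p) x) g)).
rewrite zs_tmulE (zsa_one Hbeta) zs_res1 mul1g.
by rewrite (ps_lactE HX).
Qed.

Lemma zs_ractE (s : zs_prod Z) (x : Y s) a :
  ps_tmul (ps_in x) (ps_in (ps_coef Y a)) = ps_in (ract x a).
Proof.
case: s x => p g x.
rewrite -[LHS]/(ps_tmul (zs_in (ps_in (X := X) (p := p) x) g)
                        (zs_in (ps_in (ps_coef X a)) 1%g)).
by rewrite zs_tmulE (zsa_coefE Hbeta) zs_res_1 mulg1 (ps_ractE HX).
Qed.

End ZappaSzepProductSystem.

Theorem theorem3p6 (R : realType) (A : cstarAlgType R)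
    (P : monoidType) (G : groupType) (Z : zappaSzep P G)
    (X : psData A P) (beta : zsActionData Z X)
    (HX : is_product_system X) (Hbeta : is_zs_action beta) :
  is_product_system (zs_system beta).
Proof.
split.
- exact: zs_corr.
- exact: zs_assoc.
- exact: zs_unit.
- exact: zs_unitary.
- exact: zs_lactE.
- exact: zs_ractE.
Qed.
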